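(* Let $n\ge 4$ and let $x_1,\ldots,x_n$ be indeterminates, with subscripts taken modulo $n$. Then the following identity holds: $$1+\sum_{\emptyset\ne I\subsetneq\{1,\ldots,n\}}(-1)^{|I|}\prod_{B\in\mathcal{B}(I)}V(B)=\frac{\left(\prod_{i=1}^n x_i-1\right)^{n-1}}{\prod_{k=1}^n\left(1+\sum_{b=k}^{k+n-2}\prod_{a=k}^{b}x_a\right)},$$ where $|I|$ is the parity of the number of elements in $I$.
   Context: Subscripts are taken modulo $n$ (so $x_{n+1}=x_1$, etc.). For a nonempty proper subset $I$ of $\{1,\ldots,n\}$, $\mathcal{B}(I)$ is the set of all blocks of $I$: the maximal subsets of $I$ consisting of consecutive elements along the cycle $(1\,2\,\ldots\,n)$ (a block containing $n$ may start before $n$ and continue through $n$ to $1$ and further). To a block $B=\{k,k+1,\ldots,k+l\}$ (indices modulo $n$, listed in cyclic order, $0\le l<n-1$) one assigns $$V(B)=\prod_{j=k}^{k+l}\frac{\prod_{a=k}^{j}x_a}{1+\sum_{b=k}^{j}\prod_{a=k}^{b}x_a}.$$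
   Formalization: The numerator (∏x_i − 1)^{n−1} is replaced by (1 − ∏x_i)^{n−1}; as printed the identity fails for even n, since at x = 0 the left side is 1 and the right side is −1; for odd n the two agree. *)

(* Defs.v *)
From HB Require Import structures.
From mathcomp Require Import all_boot all_algebra.
From mathcomp Require Export fraction mpoly.

Set Implicit Arguments.
Unset Strict Implicit.
Unset Printing Implicit Defensive.

Import GRing.Theory.
Local Open Scope ring_scope.

(** The indices 1, ..., n are represented by the elements 0, ..., n - 1 of
    ['I_n]; [ordS] is the successor along the cycle (1 2 ... n). *)

Section Blocks.

Variable n : nat.
Implicit Types (k : 'I_n) (l : nat) (I B : {set 'I_n}).

Definition cshift k l : 'I_n := iter l (@ordS n) k.

(** {k, k+1, ..., k+l} modulo n; it has [l.+1] elements when [l < n]. *)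
Definition arc k l : {set 'I_n} := [set cshift k j | j : 'I_l.+1].

(** [l : 'I_n.-1] encodes 0 <= l < n - 1: arcs are nonempty and proper, so that
    [k] and [l] are determined by the set [arc k l] (see [arc_inj] below). *)
Definition is_arc B : bool :=
  [exists k : 'I_n, exists l : 'I_n.-1, B == arc k l].

(** Intended for nonempty proper I: the full cycle is not an arc. *)
Definition blocks I : {set {set 'I_n}} :=
  [set B | maxset (fun A => is_arc A && (A \subset I)) B].

End Blocks.

Section Weights.

Variables (F : fieldType) (n : nat) (x : 'I_n -> F).
Implicit Types (k : 'I_n) (l : nat) (B : {set 'I_n}).

(** x_k x_(k+1) ... x_(k+l), with l + 1 factors *)
Definition cprod k l : F := \prod_(a < l.+1) x (cshift k a).

(** 1 + \sum_(b = k)^(k+l) x_k ... x_b *)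
Definition cden k l : F := 1 + \sum_(b < l.+1) cprod k b.

Definition Varc k l : F := \prod_(j < l.+1) (cprod k j / cden k j).

(** V(B), read off from the unique presentation B = {k, ..., k+l} with
    0 <= l < n - 1 (see [V_arc]); the value 0 on sets that are not arcs is
    never used. *)
Definition V B : F :=
  if [pick kl : 'I_n * 'I_n.-1 | B == arc kl.1 kl.2] is Some kl
  then Varc kl.1 kl.2 else 0.

End Weights.

Section ArcFacts.

Variable n : nat.
Implicit Types (k : 'I_n) (l : nat).

Lemma cshift_val k l : cshift k l = ((k + l) %% n)%N :> nat.
Proof.
elim: l => [|l IHl] /=; first by rewrite addn0 modn_small.
by rewrite IHl -addn1 modnDml addn1 addnS.
Qed.

Lemma cshift_inj k i j : (i < n)%N -> (j < n)%N ->
  cshift k i = cshift k j -> i = j.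
Proof.
move=> lt_i lt_j /(congr1 val) /=; rewrite !cshift_val => /eqP.
by rewrite eqn_modDl !modn_small // => /eqP.
Qed.

Lemma card_arc k l : (l < n)%N -> #|arc k l| = l.+1.
Proof.
move=> lt_l; rewrite card_imset ?card_ord // => i j eq_ij; apply/val_inj.
by apply: cshift_inj eq_ij; apply: leq_trans (ltn_ord _) lt_l.
Qed.

Lemma arc_inj k k' l l' : (l < n.-1)%N -> (l' < n.-1)%N ->
  arc k l = arc k' l' -> k = k' /\ l = l'.
Proof.
move=> lt_l lt_l' eq_arc.
have lt_n m : (m < n.-1)%N -> (m.+1 < n)%N by case: (n).
have eq_l : l = l'.
  have := congr1 (fun B : {set _} => #|B|) eq_arc.
  by rewrite !card_arc => [[]||]; rewrite ?(ltnW (lt_n _ _)).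
split=> //; rewrite -{l' lt_l'}eq_l in eq_arc.
have : k \in arc k' l by rewrite -eq_arc; apply/imsetP; exists ord0.
case/imsetP=> [[[|i] lt_i] _ /= eq_k] //.
(* the predecessor of k lies in arc k' l but not in arc k l *)
have /imsetP[j _ eq_j] : cshift k' i \in arc k l.
  by rewrite eq_arc; apply/imsetP; exists (Ordinal (ltnW lt_i)).
have : cshift k 0 = cshift k j.+1 by rewrite /= -/(cshift k j) -eq_j.
move/cshift_inj=> -/(_ (leq_ltn_trans (leq0n _) (lt_n _ lt_l))).
by move/(_ (leq_ltn_trans (ltn_ord j) (lt_n _ lt_l))).
Qed.

Lemma V_arc (F : fieldType) (x : 'I_n -> F) k l :
  (l < n.-1)%N -> V x (arc k l) = Varc x k l.
Proof.
move=> lt_l; rewrite /V; case: pickP => [[k' l'] /= /eqP eq_arc|].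
  by have [-> ->] := arc_inj lt_l (ltn_ord l') eq_arc.
by move/(_ (k, Ordinal lt_l)); rewrite /= eqxx.
Qed.

End ArcFacts.

(* Main.v *)
Require Import Defs.
From mathcomp Require Import all_boot all_algebra.
From mathcomp Require Import qpoly zify ring.

Set Implicit Arguments.
Unset Strict Implicit.
Unset Printing Implicit Defensive.

Import Defs GRing.Theory.
Local Open Scope ring_scope.

(** The idea is to put the weights on a line, to evaluate the signed sum with
    the starting point of one segment fixed, and to add the results up by
    Lagrange interpolation.

    Unroll the cycle: let y_m = x_0 ... x_(m-1), with indices read modulo n,
    and let Y_m = y_0 + ... + y_(m-1).  In a block that starts at s, the factor
    of V contributed by the position p is y_(p+1) / (Y_(p+2) - Y_s).  An element
    p of I therefore glues y_p and y_(p+1) into one segment, a non-element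
    cuts between them, and a proper subset I is a way to cut the cycle of the
    y's into segments.

    On a line, the signed sum over all ways to continue an open segment
    has a closed product form ([sum_scan]).  It comes from a short recursion,
    one step per position.  When y_s, ..., y_b are positive rates of independent
    exponential clocks, it is the probability that the clocks p, p+1, ..., b
    ring in this order, given that the clocks p, p-1, ..., s ring in this order.

    On the cycle, let c be the last non-element of I in 0, ..., n-1.  The
    segment that starts at c+1 runs through n, and the rest of the cycle is
    free, so that the sum over all I with this c is given by the linear formula
    ([sum_scan_last_false]).  Since y_(n+i) = q y_i with q the product of
    the x's, it equals, up to the common factor y_1 ... y_n,
      1 / (S_c prod_(i <> c) (Y_(c+1) - Y_(i+1))),
    where S_i = Y_(n+i+1) - Y_(i+1).  Quasi-periodicity also gives
    S_i - S_c = (1 - q) (Y_(c+1) - Y_(i+1)), so that the sum over c becomes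
      (1 - q)^(n-1) / (S_0 ... S_(n-1)) * sum_c prod_(i <> c) S_i / (S_i - S_c),
    and the last sum is the value at 0 of the polynomial that
    interpolates the constant 1 at the nodes S_i, namely 1 ([sum_scan_cyclic]).
    Finally S_i / y_(i+1) is the denominator attached to the start i+1.

    All divisions are legitimate because the elements involved are images of
    polynomials with a nonzero value at some point. *)

(** * Sums over binary words *)

Section Words.

Implicit Types (m : nat) (w : bitseq).

Definition bitseqs m : seq bitseq := [seq val t | t : m.-tuple bool].

Lemma mem_bitseqs m w : (w \in bitseqs m) = (size w == m).
Proof.
apply/imageP/eqP => [[t _ ->]|sz_w]; first exact: size_tuple.
by exists (Tuple (introT eqP sz_w)).
Qed.

Lemma bitseqs_uniq m : uniq (bitseqs m).
Proof. by rewrite map_inj_uniq ?enum_uniq //; apply: val_inj. Qed.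

Lemma bitseqs0 : bitseqs 0 = [:: [::]].
Proof.
apply/perm_small_eq => //; apply/uniq_perm=> //; first exact: bitseqs_uniq.
by move=> w; rewrite mem_bitseqs inE size_eq0.
Qed.

Variables (T : Type) (idx : T) (op : Monoid.com_law idx).

Lemma big_bitseqs_cons m (G : bitseq -> T) :
  \big[op/idx]_(w <- bitseqs m.+1) G w =
  op (\big[op/idx]_(w <- bitseqs m) G (false :: w))
     (\big[op/idx]_(w <- bitseqs m) G (true :: w)).
Proof.
have consI (b : bool) : injective (cons b) by move=> ? ? [].
rewrite -!(big_map (cons _) xpredT) -big_cat; apply/perm_big/uniq_perm.
- exact: bitseqs_uniq.
- rewrite cat_uniq !(map_inj_uniq (consI _)) !bitseqs_uniq andbT.
  by apply/hasPn=> _ /mapP[w _ ->]; apply/mapP=> -[].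
move=> [|b w]; rewrite mem_cat.
  by rewrite mem_bitseqs; symmetry; apply/negP=> /orP[] /mapP[].
rewrite mem_bitseqs eqSS -mem_bitseqs; case: b; rewrite mem_map //=.
  by rewrite orbC; case: (_ \in _) => //=; apply/esym/mapP => -[].
by case: (_ \in _) => //=; apply/esym/mapP => -[].
Qed.

Lemma big_bitseqs_rcons m (P : pred bitseq) (G : bitseq -> T) :
  \big[op/idx]_(w <- bitseqs m.+1 | P w) G w =
  op (\big[op/idx]_(w <- bitseqs m | P (rcons w false)) G (rcons w false))
     (\big[op/idx]_(w <- bitseqs m | P (rcons w true)) G (rcons w true)).
Proof.
have rconsI (b : bool) : injective (rcons^~ b) by exact: rcons_injl.
rewrite -!(big_map (rcons^~ _) P) -big_cat; apply/perm_big/uniq_perm.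
- exact: bitseqs_uniq.
- rewrite cat_uniq !(map_inj_uniq (rconsI _)) !bitseqs_uniq andbT.
  apply/hasPn=> _ /mapP[w _ ->]; apply/mapP=> -[v _ /eqP].
  by rewrite eqseq_rcons andbF.
case/lastP=> [|w b]; rewrite mem_cat mem_bitseqs.
  by symmetry; apply/negP=> /orP[] /mapP[[]].
have rconsN c : (rcons w b \in [seq rcons v c | v <- bitseqs m])
              = (w \in bitseqs m) && (b == c).
  apply/mapP/andP=> [[v v_in /eqP]|[w_in /eqP->]]; last by exists w.
  by rewrite eqseq_rcons => /andP[/eqP-> ->].
rewrite size_rcons eqSS -mem_bitseqs !rconsN {rconsN}.
by case: b; case: (_ \in _).
Qed.

(** A word with a 0 is determined by the part before its last 0; the part after
    it consists of 1s. *)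
Lemma big_bitseqs_last_false n (G : bitseq -> T) :
  \big[op/idx]_(w <- bitseqs n | w != nseq n true) G w =
  \big[op/idx]_(c < n) \big[op/idx]_(w <- bitseqs c)
    G (w ++ false :: nseq (n - c.+1) true).
Proof.
elim: n G => [|n IHn] G; first by rewrite bitseqs0 big_ord0 big_cons big_nil.
rewrite big_bitseqs_rcons big_ord_recr /= Monoid.mulmC.
have nseqSr : true :: nseq n true = rcons (nseq n true) true.
  by rewrite -cats1 -(nseqD n 1) addn1.
rewrite nseqSr; congr (op _ _).
  under eq_bigl do rewrite eqseq_rcons andbT.
  rewrite (IHn (fun w => G (rcons w true))); apply: eq_bigr => c _.
  apply: eq_bigr => w _; rewrite subSS rcons_cat rcons_cons.
  by rewrite -cats1 -(nseqD _ 1) addn1 -subSn // subSS.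
apply: eq_big => [w|w _]; first by rewrite eqseq_rcons andbF.
by rewrite subnn cats1.
Qed.

End Words.

(** * Subsets of the cycle as words *)

Definition word n (I : {set 'I_n}) : bitseq := [seq i \in I | i <- enum 'I_n].

Lemma size_word n (I : {set 'I_n}) : size (word I) = n.
Proof. by rewrite size_map size_enum_ord. Qed.

Lemma nth_word n (I : {set 'I_n}) (i : 'I_n) : nth false (word I) i = (i \in I).
Proof. by rewrite (nth_map i) ?size_enum_ord // nth_ord_enum. Qed.

Lemma word_eq_nseq n (I : {set 'I_n}) :
  (word I == nseq n true) = (I == [set: 'I_n]).
Proof.
apply/eqP/eqP => [eq_w|->].
  by apply/setP=> i; rewrite -nth_word eq_w nth_nseq ltn_ord inE.
apply: (@eq_from_nth _ false) => [|i]; first by rewrite size_word size_nseq.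
rewrite size_word => lt_i.
by rewrite (nth_word _ (Ordinal lt_i)) inE nth_nseq lt_i.
Qed.

Lemma big_word (T : Type) (idx : T) (op : Monoid.com_law idx) n
    (P : pred bitseq) (G : bitseq -> T) :
  \big[op/idx]_(I : {set 'I_n} | P (word I)) G (word I) =
  \big[op/idx]_(w <- bitseqs n | P w) G w.
Proof.
rewrite -(big_map (@word n) P); apply/perm_big/uniq_perm.
- rewrite map_inj_uniq ?index_enum_uniq // => I J eq_w.
  by apply/setP=> i; rewrite -!nth_word eq_w.
- exact: bitseqs_uniq.
move=> w; rewrite mem_bitseqs; apply/mapP/eqP => [[I _ ->]|sz_w].
  exact: size_word.
exists [set i : 'I_n | nth false w i]; first by rewrite mem_index_enum.
apply: (@eq_from_nth _ false) => [|i]; first by rewrite size_word.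
by rewrite sz_w => lt_i; rewrite (nth_word _ (Ordinal lt_i)) inE.
Qed.

(** * The signed sum along a line *)

Section Scan.

Variables (F : fieldType) (y : nat -> F).
Implicit Types (s p m : nat) (w : bitseq).

Definition psum m : F := \sum_(i < m) y i.

(** The factor of V contributed by position p of a block that starts at s: with
    y_m = x_0 ... x_(m-1) it is the quotient of x_s ... x_p by
    1 + x_s + ... + x_s ... x_p. *)
Definition gain s p : F := y p.+1 / (psum p.+2 - psum s).

(** The signed weight of a word read from position p on, where s is the start of
    the block in progress.  The state is s and not the run length p - s: it
    stays constant along a block, and no truncated subtraction occurs. *)
Fixpoint scan s p w : F :=
  match w with
  | [::] => 1
  | false :: w' => scan p.+1 p.+1 w'
  | true :: w' => - gain s p * scan s p.+1 w'
  end.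

Lemma scan_cut s p w v :
  scan s p (w ++ false :: v) =
  scan s p w * scan (p + size w).+1 (p + size w).+1 v.
Proof.
elim: w s p => [|[] w IHw] s p /=; first by rewrite mul1r addn0.
  by rewrite IHw addSnnS mulrA.
by rewrite IHw addSnnS.
Qed.

Lemma scan_nseq s p m :
  scan s p (nseq m true) = \prod_(p <= i < p + m) - gain s i.
Proof.
elim: m p => [|m IHm] p /=; first by rewrite addn0 big_geq.
by rewrite IHm addSnnS [RHS]big_ltn // -addSnnS ltn_addr.
Qed.

Lemma psumS m : psum m.+1 = psum m + y m.
Proof. exact: big_ord_recr. Qed.

Hypothesis psum_inj : injective psum.

Let psumB_neq0 i j : i != j -> psum i - psum j != 0.
Proof. by rewrite subr_eq0 (inj_eq psum_inj). Qed.

(** Induction on the number of free letters.  A first letter 0 restarts the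
    segment at p+1, a first letter 1 keeps s.  With E = Y_(p+m+1), the two
    contributions are y_(p+1) / (E - Y_(p+1)) and - y_(p+1) / (E - Y_s) times a
    common product, and
    1 / (E - Y_(p+1)) - 1 / (E - Y_s) =
    (Y_(p+1) - Y_s) / ((E - Y_(p+1)) (E - Y_s)). *)
Lemma sum_scan s p m : (s <= p)%N ->
  \sum_(w <- bitseqs m) scan s p w =
  (psum p.+1 - psum s) / (psum (p + m).+1 - psum s) *
  \prod_(p.+1 <= i < (p + m).+1) (y i / (psum (p + m).+1 - psum i)).
Proof.
elim: m s p => [|m IHm] s p le_sp.
  rewrite bitseqs0 big_seq1 addn0 big_geq // mulr1 divff // psumB_neq0 //.
  by rewrite gtn_eqF ?ltnS.
rewrite big_bitseqs_cons /= -mulr_sumr !IHm ?(leqW le_sp) // -addSnnS.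
rewrite [X in _ = _ * X]big_ltn ?ltnS ?leq_addr // psumS.
have yE : y p.+1 = psum p.+2 - psum p.+1 by rewrite psumS addrC addKr.
rewrite /gain yE; field.
by rewrite !psumB_neq0 //; lia.
Qed.

(** The start of the run of P that reaches m from the left: one more than the
    last position before m where P fails, or 0 if there is none. *)
Definition start (P : pred nat) m : nat :=
  iteri m (fun i s => if P i then s else i.+1) 0.

Lemma startP (P : pred nat) q j :
  ~~ P q -> (forall i, (q < i <= q + j)%N -> P i) -> start P (q + j).+1 = q.+1.
Proof.
move=> /negPf Pq; elim: j => [|j IHj] Pi; first by rewrite addn0 /= Pq.
rewrite addnS [LHS]/= Pi; last by lia.
by apply: IHj => i lt_i; apply: Pi; lia.
Qed.

Lemma eq_start (P Q : pred nat) m :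
  (forall i, (i < m)%N -> P i = Q i) -> start P m = start Q m.
Proof.
elim: m => //= m IHm eqPQ; rewrite eqPQ // -!/(start _ _) IHm // => i lt_i.
exact/eqPQ/ltnW.
Qed.

Lemma scan_mkseq (P : pred nat) p m :
  scan (start P p) p (mkseq (fun i => P (p + i)%N) m) =
  \prod_(p <= i < p + m | P i) - gain (start P i) i.
Proof.
elim: m p => [|m IHm] p; first by rewrite addn0 big_geq.
rewrite [RHS]big_ltn_cond; last by lia.
rewrite /mkseq /= addn0.
rewrite [iota 1 m](iotaDl 1 0) -map_comp /= -addSnnS.
rewrite (eq_map (_ : _ =1 fun i => P (p.+1 + i)%N)); last first.
  by move=> i /=; rewrite addnCA.
rewrite -IHm [start P p.+1]/=.
by case: (P p).
Qed.

End Scan.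

(** * Lagrange interpolation at 0 *)

(** Both sides are the value at 0 of the polynomial 1, the left one
    expanded in the Lagrange basis with nodes s 0, ..., s (n-1). *)
Lemma sum_lagrange0 (F : fieldType) (n : nat) (s : nat -> F) :
  (0 < n)%N -> injective s ->
  \sum_(c < n) \prod_(i < n | i != c) (s i / (s i - s c)) = 1.
Proof.
move=> n_gt0 s_inj.
have := lagrange_gen n_gt0 s_inj (p := 1).
rewrite size_poly1 => /(_ n_gt0) /(congr1 (horner^~ 0)).
rewrite horner_sum hornerC => {2}->; apply: eq_bigr => c _.
rewrite hornerM !hornerC mul1r lagrangeE // hornerM hornerC !horner_prod.
rewrite mulrC -prodf_div; apply: eq_bigr => i _.
by rewrite !hornerXsubC sub0r -(opprB (s i)) divrNN.
Qed.

(** * The signed sum around a cycle *)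

Lemma big_ord_neq (T : Type) (idx : T) (op : Monoid.law idx) n (c : 'I_n)
    (f : nat -> T) :
  \big[op/idx]_(i < n | i != c) f i =
  op (\big[op/idx]_(0 <= i < c) f i) (\big[op/idx]_(c.+1 <= i < n) f i).
Proof.
rewrite -(big_mkord (fun i => i != c :> nat)).
rewrite (@big_cat_nat _ _ _ c) ?(ltnW (ltn_ord c)) //=.
rewrite [X in op _ X]big_ltn_cond // eqxx /=.
by congr (op _ _); apply: congr_big_nat => // i lt_i; apply/eqP; lia.
Qed.

Section QuasiPeriodic.

Variables (F : fieldType) (y : nat -> F) (n : nat) (q : F).
Implicit Types (i c : nat).

Local Notation psum := (psum y).
Local Notation gain := (gain y).

Hypothesis yD : forall i, y (n + i)%N = q * y i.
Hypothesis psum_inj : injective psum.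

Let psumB_neq0 i j : i != j -> psum i - psum j != 0.
Proof. by rewrite subr_eq0 (inj_eq psum_inj). Qed.

Lemma psumD i : psum (n + i) = psum n + q * psum i.
Proof.
rewrite /psum big_split_ord /= mulr_sumr; congr (_ + _).
by apply: eq_bigr => j _; rewrite yD.
Qed.

(** If q were 0 then y_n would vanish, and two partial sums would coincide. *)
Lemma quasiperiod_neq0 : q != 0.
Proof.
apply/eqP=> q0; have /eqP := psumS y n.
by rewrite -[n in y n]addn0 yD q0 mul0r addr0 (inj_eq psum_inj) gtn_eqF.
Qed.

Lemma psumBD i j : psum (n + i) - psum (n + j) = q * (psum i - psum j).
Proof. by rewrite !psumD; ring. Qed.

Definition cycsum i : F := psum (n + i).+1 - psum i.+1.

(** The quasi-period enters the interpolation through this identity only: up to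
    the factor 1 - q, differences of the S_i are differences of partial sums. *)
Lemma cycsumB i j : cycsum i - cycsum j = (1 - q) * (psum j.+1 - psum i.+1).
Proof. by rewrite /cycsum -!addnS !psumD; ring. Qed.

Lemma gainD s p : gain (n + s) (n + p) = gain s p.
Proof.
by rewrite /gain -!addnS yD psumBD -mulf_div divff ?mul1r ?quasiperiod_neq0.
Qed.

Lemma start_last_false w m :
  start (nth false (w ++ false :: nseq m true)) (size w + m).+1 = (size w).+1.
Proof.
apply: startP => [|i /andP[lt_i le_i]]; first by rewrite nth_cat ltnn subnn.
rewrite nth_cat ltnNge ltnW //= -(subnSK lt_i) /= nth_nseq.
by case: ifP => //; lia.
Qed.

(** The segment from c+1 to n has denominators Y_(i+2) - Y_(c+1), one step ahead
    of the differences Y_(i+1) - Y_(c+1) that the interpolation formula needs.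
    The numerator Y_(n+1) - Y_(c+1), which the linear formula supplies, makes
    up for the shift by telescoping; the signs are absorbed by reversing the
    differences. *)
Lemma prod_gain_last c : (c < n)%N ->
  (psum n.+1 - psum c.+1) * \prod_(c.+1 <= i < n) - gain c.+1 i =
  y c.+1 * \prod_(c.+1 <= i < n) (y i.+1 / (psum c.+1 - psum i.+1)).
Proof.
rewrite leq_eqVlt => /predU1P[-> | lt_c].
  by rewrite !big_geq // psumS addrC addKr.
pose D k := psum k.+1 - psum c.+1.
have nzD k : (c.+1 <= k)%N -> D k != 0 by move=> lt_ck; apply: psumB_neq0; lia.
have -> : psum n.+1 - psum c.+1 = y c.+1 * \prod_(c.+1 <= i < n) (D i.+1 / D i).
  rewrite telescope_prodf // => [|k /andP[lt_k _]]; last exact/nzD/ltnW.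
  have -> : y c.+1 = D c.+1 by rewrite /D psumS addrC addKr.
  by rewrite mulrCA divff ?mulr1 // nzD.
rewrite -mulrA -big_split; congr (_ * _).
apply: eq_big_nat => i /andP[lt_i _] /=.
rewrite /gain -/(D i.+1) -(opprB (psum i.+1)) -/(D i).
by field; rewrite oppr_eq0 !nzD //; lia.
Qed.

(** The letters after the last 0, at position c, are part of the segment that
    starts at c+1 and passes through n.  Reading the word from position n with
    this start handles the free letters by [sum_scan]; the letters after
    the 0 are met near 2n and are moved back by n with [gainD]. *)
Lemma sum_scan_last_false c : (c < n)%N ->
  let v := false :: nseq (n - c.+1) true in
  \sum_(w <- bitseqs c) scan y (start (nth false (w ++ v)) n) n (w ++ v) =
  \prod_(i < n) y i.+1 *
  ((cycsum c)^-1 * \prod_(i < n | i != c :> nat) (psum c.+1 - psum i.+1)^-1).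
Proof.
move=> lt_c v.
rewrite (eq_big_seq (fun w => scan y c.+1 n w *
   \prod_(c.+1 <= i < n) - gain c.+1 i)) => [|w]; last first.
  rewrite mem_bitseqs => /eqP sz_w.
  have := start_last_false w (n - c.+1).
  rewrite sz_w -addSn subnKC // => ->.
  rewrite scan_cut scan_nseq sz_w -addnS; congr (_ * _).
  rewrite -addnA subnKC // [(n + c.+1)%N]addnC big_addn addnK.
  by apply: eq_bigr => i _; rewrite ![(_ + n)%N]addnC gainD.
rewrite -mulr_suml sum_scan // mulrAC [X in X * _]mulrAC mulrAC -/(cycsum c).
rewrite [RHS]mulrA [RHS]mulrAC; congr (_ / _).
rewrite prod_gain_last // (bigD1 (Ordinal lt_c)) //= -!mulrA; congr (_ * _).
rewrite -big_split /= (big_ord_neq _ (Ordinal lt_c)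
  (fun i => y i.+1 / (psum c.+1 - psum i.+1))) /=.
rewrite mulrC; congr (_ * _); rewrite -{1}[n.+1]add0n big_addn subSS addKn.
apply: eq_bigr => i _; rewrite addnC addSnnS -addnS yD psumBD -mulf_div.
by rewrite divff ?quasiperiod_neq0 // mul1r.
Qed.

(** The reading starts at n with the block that reaches n from the left, so that
    a block through the end of the word is weighted as a block of the cycle. *)
Lemma sum_scan_cyclic : (0 < n)%N -> q != 1 ->
  \sum_(w <- bitseqs n | w != nseq n true) scan y (start (nth false w) n) n w =
  (1 - q) ^+ n.-1 * \prod_(i < n) (y i.+1 / cycsum i).
Proof.
move=> n_gt0 q_neq1; have u_neq0 : 1 - q != 0 by rewrite subr_eq0 eq_sym.
have cycsum_inj : injective cycsum.
  move=> i j /eqP; rewrite -subr_eq0 cycsumB mulf_eq0 (negPf u_neq0) /=.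
  by rewrite subr_eq0 (inj_eq psum_inj) eqSS => /eqP.
have cycsum_neq0 i : cycsum i != 0 by rewrite psumB_neq0 //; lia.
have prod_neq0 : \prod_(i < n) cycsum i != 0 by exact/prodf_neq0.
rewrite big_bitseqs_last_false prodf_div mulrCA mulrA.
apply: (canRL (mulfK prod_neq0)).
rewrite mulr_suml -[RHS]mulr1
  -[X in _ = _ * X](sum_lagrange0 n_gt0 cycsum_inj) mulr_sumr.
apply: eq_bigr => c _.
rewrite sum_scan_last_false // -!mulrA; congr (_ * _).
rewrite (bigD1 c (P := predT)) //=.
rewrite mulrCA mulKf // prodf_div mulrC.
rewrite [RHS]mulrCA; congr (_ * _).
under [in RHS]eq_bigr do rewrite cycsumB.
rewrite big_split /= prodr_const cardC1 card_ord invfM mulVKf ?expf_neq0 //.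
by rewrite prodfV.
Qed.

End QuasiPeriodic.

(** * Blocks partition a proper subset *)

Section BlockDecomposition.

Variable n : nat.
Implicit Types (k : 'I_n) (l : nat) (I B : {set 'I_n}).

Lemma cshiftD k i j : cshift k (i + j) = cshift (cshift k i) j.
Proof. by rewrite addnC /cshift iterD. Qed.

Lemma cshiftI j : injective (fun k => cshift k j).
Proof. by elim: j => // j IHj k k' /(can_inj (@ordSK n)); apply: IHj. Qed.

Lemma arcP i k l :
  reflect (exists2 j, (j <= l)%N & i = cshift k j) (i \in arc k l).
Proof.
apply: (iffP imsetP) => [[j _ ->]|[j le_j ->]].
  by exists j; rewrite // -ltnS.
by exists (Ordinal (le_j : (j < l.+1)%N)).
Qed.

Lemma arcS k l l' : (l <= l')%N -> arc k l \subset arc k l'.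
Proof.
move=> le_l; apply/subsetP=> _ /arcP[j le_j ->]; apply/arcP; exists j => //.
exact: leq_trans le_l.
Qed.

(** If the predecessor of the start were in I, the block could be extended; the
    extension is still an arc, unless it is the whole cycle, and then I is. *)
Lemma blocksP I B : I != [set: 'I_n] -> B \in blocks I ->
  exists k l,
    [/\ (l < n.-1)%N, B = arc k l, arc k l \subset I & ord_pred k \notin I].
Proof.
move=> neq_I; rewrite inE => maxB.
have /andP[/existsP[k /existsP[l /eqP eqB]] subB] := maxsetp maxB.
exists k, l; split; rewrite -?eqB //; apply/negP=> Ik.
have lt_l : (l.+1 < n)%N by have := ltn_ord l; lia.
have sub_arc : arc (ord_pred k) l.+1 \subset I.
  apply/subsetP=> _ /arcP[[|j] lt_j ->] //.
  rewrite (cshiftD _ 1) /= ord_predK; apply: (subsetP subB).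
  by rewrite eqB; apply/arcP; exists j.
have subBarc : B \subset arc (ord_pred k) l.+1.
  rewrite eqB; apply/subsetP=> _ /arcP[j le_j ->].
  apply/arcP; exists j.+1; rewrite // (cshiftD _ 1) /=.
  by rewrite ord_predK.
have [lt_l'|ge_l] := ltnP l.+1 n.-1.
  have := maxsetsup maxB _ subBarc; rewrite sub_arc andbT => eqB'.
  have /(congr1 (fun A : {set _} => #|A|)) : arc (ord_pred k) l.+1 = B.
    apply/eqB'/existsP; exists (ord_pred k); apply/existsP.
    by exists (Ordinal lt_l').
  by rewrite eqB !card_arc //; lia.
case/negP: neq_I; rewrite eqEcard subsetT /=.
apply: leq_trans (subset_leq_card sub_arc); rewrite card_arc // cardsT card_ord.
by lia.
Qed.

(** Walk back from a common element: the block whose start is met first would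
    have the predecessor of that start in the other block, hence in I.  So the
    starts agree, one block contains the other, and maximality concludes. *)
Lemma trivIset_blocks I : I != [set: 'I_n] -> trivIset (blocks I).
Proof.
move=> neq_I; apply/trivIsetP=> A B inA inB; apply: contraNT => meetAB.
have [k [l [lt_l eqA subA Ik]]] := blocksP neq_I inA.
have [k' [l' [lt_l' eqB subB Ik']]] := blocksP neq_I inB.
have [i] := pred0Pn meetAB; rewrite /= eqA eqB => /andP[/arcP[j le_j ->]].
case/arcP=> j' le_j' eq_i.
have eq_start (k1 k2 : 'I_n) l2 j1 j2 : (j1 <= j2 <= l2)%N ->
  cshift k1 j1 = cshift k2 j2 -> ord_pred k1 \notin I ->
  arc k2 l2 \subset I -> k1 = k2.
  case/andP=> le_j12 le_j2; rewrite -{1}(subnK le_j12) cshiftD => /cshiftI->.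
  case: (j2 - j1)%N (leq_subr j1 j2) => // d lt_d; rewrite /= ordSK => /negP Id.
  by move/subsetP=> sub2; case: Id; apply/sub2/arcP; exists d => //; lia.
have eq_k : k = k'.
  have [le_jj | /ltnW le_jj] := leqP j j'.
    by apply: eq_start eq_i Ik subB; rewrite le_jj.
  by apply/esym; apply: eq_start (esym eq_i) Ik' subA; rewrite le_jj.
have maxA : maxset (fun C => is_arc C && (C \subset I)) A.
  by move: inA; rewrite inE.
have maxB : maxset (fun C => is_arc C && (C \subset I)) B.
  by move: inB; rewrite inE.
have [le_l | /ltnW le_l] := leqP l l'.
  by rewrite -eqA -eqB (maxsetsup maxA (maxsetp maxB)) // eqA eqB eq_k arcS.
by rewrite -eqA -eqB (maxsetsup maxB (maxsetp maxA)) // eqA eqB eq_k arcS.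
Qed.

Lemma cover_blocks I : I != [set: 'I_n] -> cover (blocks I) = I.
Proof.
move=> neq_I; apply/eqP; rewrite eqEsubset; apply/andP; split.
  by apply/bigcupsP=> B; rewrite inE => /maxsetp/andP[].
apply/subsetP=> i Ii; apply/bigcupP.
have arc1 : arc i 0 = [set i].
  apply/setP=> j; rewrite inE; apply/arcP/eqP=> [[[]]|->] //.
  by exists 0.
have n_gt1 : (0 < n.-1)%N.
  have [j Ij] : exists j, j \notin I.
    apply/existsP; rewrite -negb_forall; apply: contraNN neq_I => /forallP allI.
    by apply/eqP/setP=> j; rewrite inE allI.
  have : j != i by apply: contraNneq Ij => ->.
  by rewrite -val_eqE /=; have := ltn_ord i; have := ltn_ord j; lia.
have [|B maxB] := @maxset_exists _ (fun A => is_arc A && (A \subset I)) [set i].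
  rewrite sub1set Ii andbT; apply/existsP; exists i; apply/existsP.
  by exists (Ordinal n_gt1); rewrite arc1.
by rewrite sub1set => Bi; exists B; rewrite // inE.
Qed.

(** This turns the product over blocks into a product over elements, where a
    factor depends only on the distance to the start of the run. *)
Lemma prod_blocks (F : fieldType) (x h : 'I_n -> F) I : I != [set: 'I_n] ->
  (forall k j, (j < n.-1)%N -> ord_pred k \notin I ->
     (forall i, (i <= j)%N -> cshift k i \in I) ->
     h (cshift k j) = cprod x k j / cden x k j) ->
  \prod_(B in blocks I) V x B = \prod_(i in I) h i.
Proof.
move=> neq_I hE; rewrite -[in RHS](cover_blocks neq_I).
rewrite big_trivIset ?trivIset_blocks //.
apply: eq_bigr => B /(blocksP neq_I)[k [l [lt_l -> subI Ik]]].
have lt_ln : (l < n)%N by lia.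
rewrite V_arc // /arc big_imset /=; last first.
  move=> i j _ _ /cshift_inj eq_ij; apply/val_inj/eq_ij.
    exact: leq_trans (ltn_ord i) _.
  exact: leq_trans (ltn_ord j) _.
apply: eq_big => [j|j _]; first by rewrite inE.
rewrite hE // => [|i le_i]; first by have := ltn_ord j; lia.
apply: (subsetP subI); apply/arcP; exists i => //.
by rewrite (leq_trans le_i) // -ltnS.
Qed.

End BlockDecomposition.

(** * The identity over a field *)

Section Cycle.

Variables (F : fieldType) (n : nat) (x : 'I_n -> F).
Hypothesis n_gt0 : (0 < n)%N.

Let o : 'I_n := Ordinal n_gt0.

Definition cumprod m : F := \prod_(a < m) x (cshift o a).

Local Notation y := cumprod.

Lemma cshift0_ord (i : 'I_n) : cshift o i = i.
Proof. by apply/ord_inj; rewrite cshift_val add0n modn_small. Qed.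

Lemma cshift0D i : cshift o (n + i) = cshift o i.
Proof.
rewrite cshiftD; congr cshift; apply/ord_inj.
by rewrite cshift_val add0n modnn.
Qed.

Lemma cumprodD s m : y (s + m) = y s * \prod_(a < m) x (cshift (cshift o s) a).
Proof.
rewrite /y big_split_ord; congr (_ * _).
by apply: eq_bigr => a _; rewrite /= cshiftD.
Qed.

Lemma cumprod_cycle i : y (n + i) = \prod_(a < n) x a * y i.
Proof.
rewrite cumprodD; congr (_ * _).
  by apply: eq_bigr => a _; rewrite cshift0_ord.
by apply: eq_bigr => a _; rewrite -cshiftD cshift0D.
Qed.

Hypothesis x_neq0 : forall i, x i != 0.

Lemma cumprod_neq0 m : y m != 0.
Proof. exact/prodf_neq0. Qed.

Lemma cprodE s j : cprod x (cshift o s) j = y (s + j).+1 / y s.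
Proof. by rewrite -addnS cumprodD mulrAC divff ?mul1r ?cumprod_neq0. Qed.

Lemma cdenE s l :
  1 + \sum_(b < l) cprod x (cshift o s) b =
  (psum y (s + l).+1 - psum y s) / y s.
Proof.
rewrite -addnS /psum big_split_ord /= [X in X / _]addrC addKr.
rewrite big_ord_recl /= addn0.
rewrite mulrDl divff ?cumprod_neq0 // mulr_suml; congr (_ + _).
by apply: eq_bigr => b _; rewrite cprodE -addnS.
Qed.

Hypothesis cden_neq0 : forall k l, cden x k l != 0.

Lemma psum_cumprod_inj : injective (psum y).
Proof.
have lt_neq s t : (s < t)%N -> psum y t != psum y s.
  move=> lt_st; rewrite -subr_eq0 -(subnKC lt_st) addSn.
  rewrite -[_ - _](divfK (cumprod_neq0 s)) -cdenE mulf_neq0 ?cumprod_neq0 //.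
  case: (t - s.+1)%N => [|l]; first by rewrite big_ord0 addr0 oner_neq0.
  exact: cden_neq0.
move=> s t eq_st; apply/eqP.
by case: (ltngtP s t) => // /lt_neq; rewrite eq_st eqxx.
Qed.

(** The element i is weighted at its copy i + n, where the run that
    contains it has its start at a positive position even if the block
    passes through the origin. *)
Lemma prod_blocks_scan (I : {set 'I_n}) : I != [set: 'I_n] ->
  (-1) ^+ #|I| * \prod_(B in blocks I) V x B =
  scan y (start (nth false (word I)) n) n (word I).
Proof.
move=> neq_I; pose P m := cshift o m \in I.
have wordP i : (i < n)%N -> nth false (word I) i = P i.
  move=> lt_i; rewrite (nth_word I (Ordinal lt_i)) /P.
  by rewrite -(cshift0_ord (Ordinal lt_i)).
have -> : word I = mkseq (fun i => P (n + i)%N) n.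
  apply: (@eq_from_nth _ false) => [|i]; first by rewrite size_word size_mkseq.
  by rewrite size_word => lt_i; rewrite nth_mkseq // wordP // /P cshift0D.
rewrite (@eq_start _ P) => [|i lt_i]; last by rewrite nth_mkseq // /P cshift0D.
rewrite scan_mkseq -[X in index_iota X _]add0n big_addn addnK big_mkord.
pose h (i : 'I_n) := gain y (start P (i + n)) (i + n).
rewrite (@prod_blocks _ _ _ h) // => [|k j lt_j Ik kj].
  rewrite -prodrN; apply: eq_bigl => i.
  by rewrite /P addnC cshift0D cshift0_ord.
set i := cshift k j.
(* t is the non-element just before the block, in unrolled position *)
have [t tE] : exists t, (i + n = (t + j).+1)%N by exists (i + n - j.+1)%N; lia.
have tk : cshift o t.+1 = k.
  apply: (@cshiftI _ j); rewrite -cshiftD addSn -tE addnC cshift0D.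
  exact: cshift0_ord.
rewrite /h tE startP.
- rewrite -tk cprodE /cden cdenE addSn addnS /gain.
  by rewrite invf_div mulrA divfK ?cumprod_neq0.
- by rewrite /P -(ordSK (cshift o t)) -[ordS _]/(cshift o t.+1) tk.
move=> a lt_a; rewrite /P -(subnKC (_ : t.+1 <= a)%N); last by lia.
by rewrite cshiftD tk kj //; lia.
Qed.

Theorem sum_blocks : \prod_(i < n) x i != 1 ->
  \sum_(I : {set 'I_n} | I != [set: 'I_n])
     (-1) ^+ #|I| * \prod_(B in blocks I) V x B =
  (1 - \prod_(i < n) x i) ^+ n.-1
  / \prod_(k < n) (1 + \sum_(b < n.-1) cprod x k b).
Proof.
move=> q_neq1; rewrite (eq_bigr _ prod_blocks_scan).
rewrite (eq_bigl (fun I => word I != nseq n true)) => [|I]; last first.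
  by rewrite word_eq_nseq.
rewrite (big_word _ _ (fun w => w != nseq n true)
  (fun w => scan y (start (nth false w) n) n w)).
rewrite (sum_scan_cyclic cumprod_cycle psum_cumprod_inj) //; congr (_ * _).
(* the interpolation nodes have starts 1, ..., n instead of 0, ..., n - 1 *)
rewrite -prodfV [RHS](reindex_inj (can_inj (@ordSK n))) /=.
apply: eq_bigr => i _.
have -> : ordS i = cshift o i.+1 by rewrite -{1}(cshift0_ord i).
rewrite cdenE invf_div.
by rewrite /cycsum; congr (_ / (psum y _ - _)); lia.
Qed.

End Cycle.

(** * Indeterminates *)

Lemma tofrac_neq0_meval (R : idomainType) (n : nat) (v : 'I_n -> R)
    (p : {mpoly R[n]}) : p.@[v] = 1 -> tofrac p != 0.
Proof.
move=> p1; rewrite tofrac_eq0; apply: contra_eq_neq p1 => ->.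
by rewrite meval0 eq_sym oner_neq0.
Qed.

(* The numerator is (1 - x_1 ... x_n)^(n-1), which fixes the sign for even n: at
   x = 0 the left-hand side is 1, whereas (x_1 ... x_n - 1)^(n-1) is (-1)^(n-1).
   For odd n the two numerators coincide. *)
Theorem theorem6 (R : idomainType) (n : nat) (hn : (4 <= n)%N) :
  let x (i : 'I_n) : {fraction {mpoly R[n]}} := tofrac ('X_i : {mpoly R[n]}) in
  1 + \sum_(I : {set 'I_n} | (I != set0) && (I \proper [set: 'I_n]))
        (-1) ^+ #|I| * \prod_(B in blocks I) V x B
  = (1 - \prod_(i < n) x i) ^+ n.-1
    / \prod_(k < n) (1 + \sum_(b < n.-1) \prod_(a < b.+1) x (cshift k a)).
Proof.
move=> x; have n_gt0 : (0 < n)%N := ltnW (ltnW (ltnW hn)).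
have x_neq0 i : x i != 0.
  by apply: (tofrac_neq0_meval (v := fun=> 1)); rewrite mevalXU.
have cden_neq0 k l : cden x k l != 0.
  pose p : {mpoly R[n]} := 1 + \sum_(b < l.+1) \prod_(a < b.+1) 'X_(cshift k a).
  have -> : cden x k l = tofrac p.
    rewrite rmorphD rmorph1 rmorph_sum; congr (_ + _); apply: eq_bigr => b _.
    by rewrite rmorph_prod.
  apply: (tofrac_neq0_meval (v := fun=> 0)); rewrite mevalD meval1.
  rewrite rmorph_sum big1 ?addr0 // => b _.
  by rewrite rmorph_prod big_ord_recl /= mevalXU mul0r.
have prod_neq1 : \prod_(i < n) x i != 1.
  rewrite eq_sym -subr_eq0.
  have -> : 1 - \prod_(i < n) x i = tofrac (1 - \prod_(i < n) 'X_i).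
    by rewrite rmorphB rmorph1 rmorph_prod.
  apply: (tofrac_neq0_meval (v := fun=> 0)); rewrite mevalB meval1 rmorph_prod.
  by rewrite (bigD1 (Ordinal n_gt0)) //= mevalXU mul0r subr0.
have set0_neqT : set0 != [set: 'I_n].
  by rewrite -subTset; apply/subsetPn; exists (Ordinal n_gt0); rewrite ?inE.
rewrite -(sum_blocks n_gt0 x_neq0 cden_neq0 prod_neq1) [RHS](bigD1 set0) //=.
congr (_ + _); last by apply: eq_bigl => I; rewrite properT andbC.
(* the leading 1 is the term of the empty set, which has no blocks *)
rewrite cards0 expr0 mul1r (prod_blocks (h := fun=> 1)) ?big_set0 //.
by move=> k j _ _ /(_ 0%N isT); rewrite inE.
Qed.
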